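(* For every $m_2$ and $k>1$, if $n\ge m_2k-1$ there exists a data set $(Y_1,\dots,Y_n)$ of matrices in $\mathbb{R}^{m_1\times m_2}$, where $m_1=nm_2-k$, for which there are multiple, but finitely many, complex solutions (counted as points of projective space) to the Kronecker likelihood equations. The ML multiplicity of the Kronecker MLE problem is greater than one for this data set.
   Context: Here $m_1,m_2,n,k$ are positive integers. For data $Y_1,\dots,Y_n\in\mathbb{R}^{m_1\times m_2}$ with $k:=nm_2-m_1>0$, let $Y=[Y_1|\cdots|Y_n]\in\mathbb{R}^{m_1\times nm_2}$ and suppose that its left-most $m_1\times m_1$ block $Y_*$ is invertible (true for generic data). Then $Y_*^{-1}Y=[I_{m_1}|C]$ with $C\in\mathbb{R}^{m_1\times k}$, and one defines $D\in\mathbb{R}^{nm_2\times k}$ by $D^\top=[C^\top|-I_k]$. Partition the rows of $D$ into $n$ consecutive blocks of size $m_2$ and let $d_{ij}\in\mathbb{R}^{m_2}$ be the $j$th column of the $i$th block ($i\in[n]$, $j\in[k]$, where $[r]=\{1,\dots,r\}$). For $a,b\in[k]$ put $D_{ab}=\sum_{i=1}^n d_{ia}d_{ib}^\top\in\mathbb{R}^{m_2\times m_2}$. The Kronecker likelihood equations are $$m_2\det(\Sigma)\sum_{\pi\in\mathcal S_k}\operatorname{sgn}(\pi)\sum_{b=1}^k\Big(\prod_{a\ne b}\operatorname{tr}(D_{a\pi(a)}\Sigma)\Big)D_{b\pi(b)}=k\det\left([\operatorname{tr}(D_{ab}\Sigma)]_{a,b\in[k]}\right)\operatorname{adj}(\Sigma),$$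 for symmetric complex $m_2\times m_2$ matrices $\Sigma$ with $\det(\Sigma)\neq0$ and $\det([\operatorname{tr}(D_{ab}\Sigma)]_{a,b\in[k]})\ne0$; here $\mathcal S_k$ is the symmetric group on $[k]$ and $\operatorname{adj}$ the adjugate. (They express the vanishing of the gradient of $\Sigma\mapsto m_2\log\det([\operatorname{tr}(D_{ab}\Sigma)]_{a,b\in[k]})-k\log\det(\Sigma)$, whose minimization over positive definite $\Sigma$ up to scale gives the maximum likelihood estimator (MLE) in the model where the $Y_i$ are i.i.d. with $\operatorname{vec}(Y_i)\sim\mathcal N(0,\Sigma_2\otimes\Sigma_1)$, the minimizer being the estimate of $\Sigma_2$ up to scale.) The solution set is invariant under nonzero complex scaling of $\Sigma$, and the maximum likelihood (ML) multiplicity of the data set is the number of solutions regarded as points $[\Sigma]$ of the complex projective space of symmetric $m_2\times m_2$ matrices. *)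

(* Defs.v *)
From HB Require Import structures.
From mathcomp Require Import all_boot all_order all_fingroup all_algebra.
From mathcomp Require Import boolp classical_sets functions cardinality reals.
From mathcomp Require Import finmap complex.

Set Implicit Arguments.
Unset Strict Implicit.
Unset Printing Implicit Defensive.

Import Order.TTheory GRing.Theory Num.Theory.
Local Open Scope classical_set_scope.
Local Open Scope ring_scope.

(* [\mxrow_(i < n) Y i] has [\sum_(i < n) m2] columns; this equation recasts
   that number as [m1 + k], so that [lsubmx] and [rsubmx] apply. *)
Lemma block_width (m1 m2 n k : nat) (hk : (n * m2 = m1 + k)%N) :
  (\sum_(i < n) m2 = m1 + k)%N.
Proof. by rewrite sum_nat_const card_ord. Qed.

Section Data.
Variables (R : realType) (m1 m2 n k : nat) (hk : (n * m2 = m1 + k)%N).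
Variable Y : 'I_n -> 'M[R]_(m1, m2).

Definition data_row : 'M[R]_(m1, m1 + k) :=
  castmx (erefl m1, block_width hk) (\mxrow_(i < n) Y i).

Definition data_lead : 'M[R]_m1 := lsubmx data_row.

Definition data_C : 'M[R]_(m1, k) := rsubmx (invmx data_lead *m data_row).

Definition data_D : 'M[R]_(\sum_(i < n) m2, k) :=
  castmx (esym (block_width hk), erefl k) (row_mx data_C^T (- 1%:M))^T.

Definition data_d (i : 'I_n) (j : 'I_k) : 'cV[R]_m2 :=
  col j (submxcol data_D i).

Definition data_Dab (a b : 'I_k) : 'M[R]_m2 :=
  \sum_(i < n) data_d i a *m (data_d i b)^T.

End Data.

Section LikelihoodEquations.
Variables (K : comNzRingType) (m k : nat) (A : 'I_k -> 'I_k -> 'M[K]_m).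

Definition trace_mx (S : 'M[K]_m) : 'M[K]_k :=
  \matrix_(a < k, b < k) \tr (A a b *m S).

Definition likelihood_eq (S : 'M[K]_m) : Prop :=
  (m%:R * \det S) *:
    (\sum_(s : 'S_k) (-1) ^+ s *:
      \sum_(b < k)
        (\prod_(a < k | a != b) \tr (A a (s a) *m S)) *: A b (s b))
  = (k%:R * \det (trace_mx S)) *: \adj S.

Definition likelihood_solution (S : 'M[K]_m) : Prop :=
  [/\ S^T = S, \det S != 0, \det (trace_mx S) != 0 & likelihood_eq S].

End LikelihoodEquations.

(* The point [S] of projective space, for [S] nonzero, as the punctured line
   through [S]. *)
Definition proj_point (K : fieldType) (m : nat) (S : 'M[K]_m) : set 'M[K]_m :=
  [set c *: S | c in [set c : K | c != 0]].

Section Multiplicity.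
Variables (R : realType) (m1 m2 n k : nat) (hk : (n * m2 = m1 + k)%N).
Variable Y : 'I_n -> 'M[R]_(m1, m2).

Definition complex_Dab (a b : 'I_k) : 'M[R[i]]_m2 :=
  map_mx (real_complex R) (data_Dab hk Y a b).

Definition kronecker_solutions : set (set 'M[R[i]]_m2) :=
  [set proj_point S | S in [set S | likelihood_solution complex_Dab S]].

(* Only meaningful when [kronecker_solutions] is finite: [fset_set] of an
   infinite set is empty. *)
Definition ml_multiplicity : nat := #|` fset_set kronecker_solutions|%fset.

End Multiplicity.

(* Main.v *)
Require Import Defs.
From HB Require Import structures.
From mathcomp Require Import all_boot all_order all_fingroup all_algebra.
From mathcomp Require Import boolp classical_sets functions cardinality reals.
From mathcomp Require Import finmap complex.
From mathcomp Require Import zify ring.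

Set Implicit Arguments.
Unset Strict Implicit.
Unset Printing Implicit Defensive.

Import Order.TTheory GRing.Theory Num.Theory.
Local Open Scope classical_set_scope.
Local Open Scope ring_scope.

(* Write the data as blocks D_i (m2 x k) with D_ab = sum_i col_a(D_i) col_b(D_i)^T.
   On symmetric invertible S with T(S) := sum_i D_i^T S D_i invertible, the
   likelihood equations read m2 sum_i D_i T(S)^-1 D_i^T = k S^-1; they are
   unchanged by D_i := D_i g with g invertible, so the only constraint on D is
   that its last k rows be independent.

   If the m2 k vectors (D_i(p,j))_i are pairwise orthogonal with squared norms
   a(p,j), every solution S = diag(x) is diagonal, and the equations become the
   matrix scaling problem: the matrix (x_p a(p,j) y_j) has row sums k and column
   sums m2. With n >= m2 k - 1, one entry of a must vanish; taking a second
   entry of the same row (if k > 2) or column (if m2 > 2) equal to 2 and all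
   others equal to 1, the scaling problem reduces to a quadratic equation with
   two roots. Block rank is at most one while these vectors are multiples of
   unit vectors of R^n; commuting reflections of R^n, which preserve their inner
   products, make the last k rows of D independent.

   For m2 = k = 2 this problem never has two solutions; there one takes
   T(S) = S + E01 S E10 + E10 S E01, whose solutions are the identity and the
   swap matrix, up to scaling. *)

(** * Realising prescribed blocks by data: the last [k] rows *)

Definition tail_index (m1 m2 n k : nat) (hk : (n * m2 = m1 + k)%N) (t : 'I_k) :
    'I_(\sum_(i < n) m2) :=
  cast_ord (esym (block_width hk)) (rshift m1 t).

Definition tail_block m1 m2 n k hk t : 'I_n :=
  tagnat.sig1 (@tail_index m1 m2 n k hk t).

Definition tail_row m1 m2 n k hk t : 'I_m2 :=
  tagnat.sig2 (@tail_index m1 m2 n k hk t).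

Lemma tail_indexE m1 m2 n k (hk : (n * m2 = m1 + k)%N) (t : 'I_k) :
  (m1 + t = tail_block hk t * m2 + tail_row hk t)%N.
Proof.
have := tagnat.rect (tail_index hk t).
rewrite -/(tail_block hk t) /= => ->; congr (_ + _)%N.
have le_n := ltnW (ltn_ord (tail_block hk t)).
by rewrite -(big_ord_widen _ (fun=> m2) le_n) sum_nat_const card_ord.
Qed.

Lemma tail_inj m1 m2 n k (hk : (n * m2 = m1 + k)%N) (s t : 'I_k) :
  tail_block hk s = tail_block hk t -> tail_row hk s = tail_row hk t -> s = t.
Proof.
move=> e1 e2; apply/val_inj/eqP; rewrite /= -(eqn_add2l m1).
by rewrite (tail_indexE hk s) (tail_indexE hk t) e1 e2.
Qed.

Section BlocksToData.
Variables (R : realType) (m1 m2 n k : nat) (hk : (n * m2 = m1 + k)%N).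

Definition tail_mx (D : 'I_n -> 'M[R]_(m2, k)) : 'M[R]_k :=
  \matrix_(t, j) D (tail_block hk t) (tail_row hk t) j.

(* Column operations on [D] do not affect the likelihood equations up to a
   scalar, so only invertibility of the last [k] rows is a constraint. *)
Lemma blocks_to_data (D : 'I_n -> 'M[R]_(m2, k)) :
  tail_mx D \in unitmx ->
  exists Y : 'I_n -> 'M[R]_(m1, m2), data_lead hk Y \in unitmx /\
    exists2 g : 'M[R]_k, g \in unitmx &
      forall i, submxcol (data_D hk Y) i = D i *m g.
Proof.
(* This [g] turns the last [k] rows of [D] into [-1]. The first [m1] rows of the product are then
   [C], and the data [[1 | C]] have leading block [1]. *)
move=> uT; pose g := - invmx (tail_mx D).
pose Z : 'M[R]_(m1 + k, k) :=
  castmx (block_width hk, erefl k) (\mxcol_(i < n) D i).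
pose C := usubmx Z *m g.
pose Y0 : 'M[R]_(m1, \sum_(i < n) m2) :=
  castmx (erefl m1, esym (block_width hk)) (row_mx 1%:M C).
exists (fun i => submxrow Y0 i).
have rowE : data_row hk (fun i => submxrow Y0 i) = row_mx 1%:M C.
  by rewrite /data_row submxrowK /Y0 castmx_comp castmx_id.
have leadE : data_lead hk (fun i => submxrow Y0 i) = 1%:M.
  by rewrite /data_lead rowE row_mxKl.
split; first by rewrite leadE unitmx1.
exists g; first by rewrite /g -scaleN1r unitmxZ ?unitrN1 ?unitmx_inv.
move=> i; rewrite /data_D /data_C leadE invmx1 mul1mx rowE row_mxKr.
have dZ : dsubmx Z = tail_mx D.
  apply/matrixP => t j; rewrite !mxE castmxE mxE cast_ord_id.
  by congr (D _ _ _).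
rewrite tr_row_mx trmxK linearN /= trmx1.
have -> : col_mx C (- 1%:M) = Z *m g.
  rewrite -[Z]vsubmxK mul_col_mx dZ; congr col_mx.
  by rewrite /g mulmxN mulmxV.
rewrite -[D i in RHS](mxcolK D) submxcol_mul; congr submxcol.
by apply/matrixP => a b; rewrite !(castmxE, mxE); apply: eq_bigr => j _;
  rewrite castmxE /= !cast_ord_id cast_ordKV.
Qed.

End BlocksToData.

(** * The likelihood equations as a matrix equation in the blocks *)

Lemma cofactor_expansion_sum (K : comNzRingType) (V : lmodType K) (k : nat)
    (T : 'M[K]_k) (A : 'I_k -> 'I_k -> V) :
  \sum_(s : 'S_k) (-1) ^+ s *:
     \sum_(b < k) (\prod_(a < k | a != b) T a (s a)) *: A b (s b)
  = \sum_(b < k) \sum_(c < k) cofactor T b c *: A b c.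
Proof.
under eq_bigr do rewrite scaler_sumr.
rewrite exchange_big; apply: eq_bigr => b _ /=.
(* For fixed [b], the permutations with [s b = c] give the Leibniz expansion of the cofactor at
   [(b, c)]. *)
rewrite (partition_big (fun s : 'S_k => s b) xpredT) //=.
apply: eq_bigr => c _; rewrite expand_cofactor scaler_suml.
apply: eq_bigr => s /eqP <-; rewrite scalerA.
by congr (_ * _ *: _); apply: eq_bigl => a; rewrite eq_sym.
Qed.

Lemma invmx_uniq (F : comUnitRingType) r (A B : 'M[F]_r) :
  A *m B = 1%:M -> invmx A = B.
Proof.
move=> AB; have [uA _] := mulmx1_unit AB.
by rewrite -[RHS](mulKmx uA) AB mulmx1.
Qed.

Lemma adj_invmx (F : fieldType) r (M : 'M[F]_r) :
  M \in unitmx -> \adj M = \det M *: invmx M.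
Proof.
move=> uM; rewrite /invmx uM scalerA divff ?scale1r //.
by rewrite -unitfE -unitmxE.
Qed.

Section BlockEquations.
Variables (K : numFieldType) (m k n : nat).
Implicit Type D : 'I_n -> 'M[K]_(m, k).

Definition block_gram D (S : 'M[K]_m) : 'M[K]_k :=
  \sum_i (D i)^T *m S *m D i.

(** The adjoint of [block_gram D] for the trace pairing: the trace of [block_push D X *m S] equals
    that of [X *m block_gram D S]. *)
Definition block_push D (X : 'M[K]_k) : 'M[K]_m :=
  \sum_i D i *m X *m (D i)^T.

Definition block_solution D (S : 'M[K]_m) : Prop :=
  [/\ S^T = S, S \in unitmx, block_gram D S \in unitmx &
      m%:R *: block_push D (invmx (block_gram D S)) = k%:R *: invmx S].

Lemma block_gram_sym D S : S^T = S -> (block_gram D S)^T = block_gram D S.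
Proof.
move=> sS; rewrite /block_gram raddf_sum; apply: eq_bigr => i _ /=.
by rewrite !trmx_mul trmxK sS mulmxA.
Qed.

Lemma block_pushZ D a X : block_push D (a *: X) = a *: block_push D X.
Proof.
rewrite /block_push scaler_sumr; apply: eq_bigr => i _.
by rewrite -scalemxAr -scalemxAl.
Qed.

(** With [P] the Gram matrix, [trace_mx A S] is the transpose of [P], and [P] is symmetric because
    [S] is. The permutation sum is therefore [block_push D (\adj P)]. Writing both adjugates as
    determinant times inverse, the two sides share the nonzero factor [\det S * \det P], which
    cancels. *)
Lemma block_solutionP D A S :
  (forall a b, A a b = \sum_i col a (D i) *m (col b (D i))^T) ->
  likelihood_solution A S <-> block_solution D S.
Proof.
move=> AE.
have trE a b : \tr (A a b *m S) = block_gram D S b a.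
  rewrite AE mulmx_suml raddf_sum summxE; apply: eq_bigr => i _ /=.
  rewrite -mulmxA mxtrace_mulC /mxtrace big_ord1 !mxE.
  apply: eq_bigr => p _; rewrite !mxE; congr (_ * _).
  by apply: eq_bigr => q _; rewrite !mxE.
have trE' : trace_mx A S = (block_gram D S)^T.
  by apply/matrixP => a b; rewrite !mxE trE.
rewrite /likelihood_solution /block_solution trE' det_tr -!unitfE -!unitmxE.
set P := block_gram D S in trE *.
have sumE : S^T = S -> \sum_(s : 'S_k) (-1) ^+ s *:
      \sum_(b < k)
        (\prod_(a < k | a != b) \tr (A a (s a) *m S)) *: A b (s b)
    = block_push D (\adj P).
  move=> sS; have sP : P^T = P by exact: block_gram_sym.
  transitivity (\sum_(b < k) \sum_(c < k) cofactor P b c *: A b c).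
    rewrite -cofactor_expansion_sum; apply: eq_bigr => s _; congr (_ *: _).
    apply: eq_bigr => b _; congr (_ *: _); apply: eq_bigr => a _.
    by rewrite trE -[in LHS]sP mxE.
  have -> : \adj P = \matrix_(b, c) cofactor P b c.
    by rewrite -{1}sP -trmx_adj; apply/matrixP => b c; rewrite !mxE.
  apply/matrixP => p q; rewrite !summxE.
  transitivity (\sum_b \sum_c \sum_i cofactor P b c * (D i p b * D i q c)).
    apply: eq_bigr => b _; rewrite summxE; apply: eq_bigr => c _.
    rewrite mxE AE summxE mulr_sumr; apply: eq_bigr => i _.
    by rewrite !mxE big_ord1 !mxE.
  under eq_bigr => b _ do rewrite exchange_big.
  rewrite exchange_big; apply: eq_bigr => i _ /=.
  rewrite mxE exchange_big; apply: eq_bigr => c _ /=.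
  rewrite !mxE mulr_suml; apply: eq_bigr => b _.
  by rewrite !mxE mulrCA mulrA.
have eqE : S \in unitmx -> P \in unitmx ->
    (m%:R * \det S) *: block_push D (\adj P) = (k%:R * \det P) *: \adj S <->
    m%:R *: block_push D (invmx P) = k%:R *: invmx S.
  move=> uS uP; rewrite !adj_invmx // block_pushZ !scalerA.
  have dS : \det S * \det P != 0 by rewrite mulf_neq0 -?unitfE -?unitmxE.
  have -> : m%:R * \det S * \det P = \det S * \det P * m%:R by ring.
  have -> : k%:R * \det P * \det S = \det S * \det P * k%:R by ring.
  rewrite -2![(_ * _ * _%:R) *: _]scalerA.
  by split=> [/(can_inj (scalerK dS))|->].
split=> [] [sS uS uP E]; split=> //; move: E;
  by rewrite /likelihood_eq trE' det_tr -/P sumE // eqE.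
Qed.

(** The Gram matrix [P] becomes [g^T *m P *m g]; the factors of its inverse cancel those that [g]
    puts into [block_push]. *)
Lemma block_solution_mulmx D (g : 'M[K]_k) S :
  g \in unitmx -> block_solution (fun i => D i *m g) S <-> block_solution D S.
Proof.
move=> ug.
have gramE : block_gram (fun i => D i *m g) S = g^T *m block_gram D S *m g.
  rewrite /block_gram mulmx_sumr mulmx_suml; apply: eq_bigr => i _.
  by rewrite trmx_mul !mulmxA.
rewrite /block_solution gramE !unitmx_mul unitmx_tr ug andbT /=.
set P := block_gram D S.
have pushE : P \in unitmx ->
    block_push (fun i => D i *m g) (invmx (g^T *m P *m g))
    = block_push D (invmx P).
  move=> uP; apply: eq_bigr => i _.
  have -> : invmx (g^T *m P *m g) = invmx g *m invmx P *m (invmx g)^T.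
    apply: invmx_uniq; rewrite -!mulmxA (mulmxA g) mulmxV // mul1mx.
    by rewrite (mulmxA P) mulmxV // mul1mx -trmx_mul mulVmx // trmx1.
  rewrite trmx_mul !mulmxA mulmxK // -(mulmxA _ _ g^T).
  by rewrite -trmx_mul mulmxV // trmx1 mulmx1.
by split=> [] [sS uS uP E]; split=> //; move: E; rewrite pushE.
Qed.

End BlockEquations.

(** * Solutions as points of projective space *)

Lemma proj_pointP (K : fieldType) m (S S' : 'M[K]_m) :
  proj_point S S' <-> exists2 c, c != 0 & S' = c *: S.
Proof. by split=> [[c c0 <-]|[c c0 ->]]; exists c. Qed.

Lemma proj_pointZ (K : fieldType) m (S : 'M[K]_m) (c : K) :
  c != 0 -> proj_point (c *: S) = proj_point S.
Proof.
move=> c0; apply/seteqP; split=> S' /proj_pointP[d d0 ->]; apply/proj_pointP.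
  by exists (d * c); rewrite ?mulf_neq0 // scalerA.
by exists (d / c); rewrite ?mulf_neq0 ?invr_eq0 // scalerA divfK.
Qed.

(** Exactly two solutions up to scaling. The scalar [c] in the third clause may be zero, so [S2] is
    also nonzero. *)
Definition two_rays (K : fieldType) (V : lmodType K) (sol : V -> Prop) : Prop :=
  exists S1 S2, [/\ sol S1, sol S2, forall c, S2 <> c *: S1 &
    forall S, sol S -> exists2 c, c != 0 & S = c *: S1 \/ S = c *: S2].

Lemma multiple_solutions_of_blocks (R : realType) (m1 m2 n k : nat)
    (hk : (n * m2 = m1 + k)%N) (D : 'I_n -> 'M[R]_(m2, k)) :
  tail_mx hk D \in unitmx ->
  two_rays (block_solution (fun i => map_mx (real_complex R) (D i))) ->
  exists Y : 'I_n -> 'M[R]_(m1, m2),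
    [/\ data_lead hk Y \in unitmx,
        finite_set (kronecker_solutions hk Y),
        (exists P Q : set 'M[R[i]]_m2,
          [/\ kronecker_solutions hk Y P,
              kronecker_solutions hk Y Q & P <> Q]) &
        (1 < ml_multiplicity hk Y)%N].
Proof.
move=> uT [S1 [S2 [sol1 sol2 neq S12]]].
have [Y [uY [g ug DE]]] := blocks_to_data uT; exists Y.
have solE S : likelihood_solution (complex_Dab hk Y) S <->
    block_solution (fun i => map_mx (real_complex R) (D i)) S.
  have ugC : map_mx (real_complex R) g \in unitmx by rewrite map_unitmx.
  rewrite -(block_solution_mulmx _ _ ugC).
  apply: block_solutionP => a b; rewrite /complex_Dab /data_Dab raddf_sum.
  apply: eq_bigr => i _ /=; rewrite map_mxM -map_trmx /data_d DE.
  by rewrite !map_col map_mxM.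
have neqP : proj_point S1 <> proj_point S2.
  move=> E; have /proj_pointP[c _] : proj_point S1 S2.
    by rewrite E; apply/proj_pointP; exists 1; rewrite ?oner_eq0 ?scale1r.
  exact: neq.
have kE : kronecker_solutions hk Y = [set proj_point S1; proj_point S2].
  apply/seteqP; split=> [P [S /solE /S12[c c0 SE] <-]|P].
    by case: SE => ->; rewrite proj_pointZ //; [left|right].
  by case=> ->; [exists S1|exists S2] => //; apply/solE.
split=> //; first by rewrite kE; exact: finite_set2.
  by exists (proj_point S1), (proj_point S2); rewrite kE; split=> //; [left|right].
rewrite /ml_multiplicity kE fset_setU ?finite_set1 // !fset_set1.
by rewrite cardfs2; case: eqP.
Qed.

(** * Orthogonal entry vectors: reduction to matrix scaling *)

Section DiagonalBlocks.
Variable K : numFieldType.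

Lemma unitmx_diag r (d : 'rV[K]_r) :
  (diag_mx d \in unitmx) <-> forall i, d 0 i != 0.
Proof.
rewrite unitmxE det_diag unitfE prodf_seq_neq0; split=> [/allP d0 i|d0].
  by have := d0 i (mem_index_enum i).
by apply/allP => i _; exact: d0.
Qed.

Lemma invmx_diag r (d : 'rV[K]_r) : (forall i, d 0 i != 0) ->
  invmx (diag_mx d) = diag_mx (\row_i (d 0 i)^-1).
Proof.
move=> d0; apply: invmx_uniq; apply/matrixP => i j.
rewrite mul_diag_mx !mxE; case: eqVneq => [->|_]; last by rewrite mulr0n mulr0.
by rewrite !mulr1n mulfV.
Qed.

Variables m k : nat.

Definition scaling (a : 'I_m -> 'I_k -> K) (x : 'rV[K]_m) (y : 'rV[K]_k) :=
  (forall p, x 0 p * (\sum_j a p j * y 0 j) = k%:R) /\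
  (forall j, y 0 j * (\sum_p a p j * x 0 p) = m%:R).

Variables (n : nat) (D : 'I_n -> 'M[K]_(m, k)) (a : 'I_m -> 'I_k -> K).
Hypothesis DE : forall p j p' j', \sum_i D i p j * D i p' j'
  = if (p == p') && (j == j') then a p j else 0.

Lemma block_gram_diag S :
  block_gram D S = diag_mx (\row_j \sum_p a p j * S p p).
Proof.
apply/matrixP => j j'; rewrite summxE.
transitivity (\sum_p \sum_p' S p p' * \sum_i D i p j * D i p' j').
  under eq_bigr => i _ do (rewrite mxE; under eq_bigr => p' _ do
    rewrite mxE mulr_suml).
  rewrite exchange_big /=; under eq_bigr => p' _ do rewrite exchange_big /=.
  rewrite exchange_big /=; apply: eq_bigr => p _; apply: eq_bigr => p' _.
  rewrite mulr_sumr; apply: eq_bigr => i _; rewrite mxE; ring.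
rewrite !mxE -sumrMnl; apply: eq_bigr => p _.
rewrite [LHS](bigD1 p) //= [X in _ + X]big1 ?addr0 => [|p' p'p].
  by rewrite DE eqxx /=; case: eqP => _; rewrite ?mulr0 // mulrC.
by rewrite DE eq_sym (negPf p'p) mulr0.
Qed.

Lemma block_push_diag X :
  block_push D X = diag_mx (\row_p \sum_j a p j * X j j).
Proof.
apply/matrixP => p p'; rewrite summxE.
transitivity (\sum_j \sum_j' X j j' * \sum_i D i p j * D i p' j').
  under eq_bigr => i _ do (rewrite mxE; under eq_bigr => j' _ do
    rewrite mxE mulr_suml).
  rewrite exchange_big /=; under eq_bigr => j' _ do rewrite exchange_big /=.
  rewrite exchange_big /=; apply: eq_bigr => j _; apply: eq_bigr => j' _.
  rewrite mulr_sumr; apply: eq_bigr => i _; rewrite mxE; ring.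
rewrite !mxE -sumrMnl; apply: eq_bigr => j _.
rewrite [LHS](bigD1 j) //= [X in _ + X]big1 ?addr0 => [|j' j'j].
  by rewrite DE eqxx andbT; case: eqP => [->|_]; rewrite ?mulr0 // mulrC.
by rewrite DE (eq_sym j) (negPf j'j) andbF mulr0.
Qed.

(** [block_push] has diagonal values only, so the likelihood equation makes [invmx S], hence [S],
    diagonal. With [t] the diagonal of the Gram matrix, put [y_j = m / t_j]: the column sums hold by
    this choice, and the row sums are the likelihood equation. *)
Lemma block_solution_diag S : (0 < m)%N -> (0 < k)%N ->
  block_solution D S <-> exists2 x, S = diag_mx x & exists y, scaling a x y.
Proof.
move=> m_gt0 k_gt0.
have m0 : m%:R != 0 :> K by rewrite pnatr_eq0 -lt0n.
have k0 : k%:R != 0 :> K by rewrite pnatr_eq0 -lt0n.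
split=> [[sS uS]|[x SE [y [xE yE]]]].
  rewrite block_gram_diag; set t := \row_j _ => ut.
  have t0 := (unitmx_diag t).1 ut.
  rewrite (invmx_diag t0) block_push_diag; set w := \row_p _ => E.
  have SVE : invmx S = diag_mx ((m%:R / k%:R) *: w).
    by rewrite linearZ /= mulrC -scalerA E scalerK ?unitfE.
  have r0 := (unitmx_diag ((m%:R / k%:R) *: w)).1.
  rewrite -SVE unitmx_inv in r0; move/(_ uS) in r0.
  exists (\row_p (((m%:R / k%:R) *: w) 0 p)^-1).
    by rewrite -(invmx_diag r0) -SVE invmxK.
  have SE : S = diag_mx (\row_p (((m%:R / k%:R) *: w) 0 p)^-1).
    by rewrite -(invmx_diag r0) -SVE invmxK.
  exists (\row_j (m%:R / t 0 j)); split=> [p|j]; rewrite mxE.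
    have -> : \sum_j a p j * (\row_j (m%:R / t 0 j)) 0 j
        = k%:R * ((m%:R / k%:R) *: w) 0 p.
      rewrite !mxE mulrA [k%:R * _]mulrC divfK // mulr_sumr.
      by apply: eq_bigr => j _; rewrite !mxE eqxx mulr1n mulrCA.
    by rewrite mulrCA mulVf ?mulr1 //; exact: r0.
  have -> : \sum_p a p j * (\row_p (((m%:R / k%:R) *: w) 0 p)^-1) 0 p = t 0 j.
    by rewrite [RHS]mxE; apply: eq_bigr => p _; rewrite SE !mxE eqxx mulr1n.
  by rewrite divfK //; exact: t0.
(* Conversely, the products in [scaling] equal the nonzero numbers [k] and [m], so [S] and its Gram
   matrix are invertible. *)
have x0 p : x 0 p != 0.
  by apply: contraNneq k0 => x0; rewrite -(xE p) x0 mul0r.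
have t0 j : \sum_p a p j * x 0 p != 0.
  by apply: contraNneq m0 => t0; rewrite -(yE j) t0 mulr0.
have gramE : block_gram D S = diag_mx (\row_j \sum_p a p j * x 0 p).
  rewrite block_gram_diag; congr diag_mx; apply/rowP => j; rewrite !mxE.
  by apply: eq_bigr => p _; rewrite SE !mxE eqxx mulr1n.
have t0' j : (\row_j \sum_p a p j * x 0 p) 0 j != 0 by rewrite mxE.
split.
- by rewrite SE tr_diag_mx.
- by rewrite SE; apply/unitmx_diag.
- by rewrite gramE; apply/unitmx_diag.
rewrite gramE invmx_diag // SE invmx_diag // block_push_diag -!linearZ /=.
congr diag_mx; apply/rowP => p; rewrite !mxE -[in RHS](xE p).
rewrite mulrAC mulfV // mul1r mulr_sumr; apply: eq_bigr => j _.
rewrite !mxE eqxx mulr1n -{1}(yE j) mulrCA; congr (_ * _).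
by rewrite mulfK.
Qed.

Lemma two_rays_diag : (0 < m)%N -> (0 < k)%N ->
  two_rays (fun x => exists y, scaling a x y) -> two_rays (block_solution D).
Proof.
move=> m0 k0 [x1 [x2 [s1 s2 neq s12]]].
exists (diag_mx x1), (diag_mx x2); split.
- by apply/block_solution_diag => //; exists x1.
- by apply/block_solution_diag => //; exists x2.
- move=> c /matrixP E; apply: (neq c); apply/rowP => p.
  by have := E p p; rewrite !mxE eqxx !mulr1n.
move=> S /(block_solution_diag _ m0 k0)[x -> /s12[c c0 xE]].
by exists c => //; rewrite -!linearZ /=; case: xE => ->; [left|right].
Qed.

End DiagonalBlocks.

(** * Scaling a perturbed all-ones matrix *)

Section MatrixScaling.
Variable K : numFieldType.

Lemma scaling_sym m k (a : 'I_m -> 'I_k -> K) x y :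
  scaling a x y <-> scaling (fun j p => a p j) y x.
Proof. by split=> [] []. Qed.

Lemma scalingE m k (a : 'I_m -> 'I_k -> K) x y : (0 < m)%N -> scaling a x y ->
  y = \row_j (m%:R / (\sum_p a p j * x 0 p)).
Proof.
move=> m_gt0 [_ yE]; apply/rowP => j; rewrite mxE -(yE j) mulfK //.
apply: contraTneq m_gt0 => t0; have := yE j.
by rewrite t0 mulr0 => /esym/eqP; rewrite pnatr_eq0 => /eqP ->.
Qed.

Lemma scaling_homogeneous m k (a : 'I_m -> 'I_k -> K) x y x' y' c :
  (0 < m)%N -> scaling a x y -> scaling a x' y' ->
  x' = c *: x -> y' = c^-1 *: y.
Proof.
move=> m0 /(scalingE m0) yE /(scalingE m0) y'E x'E.
apply/rowP => j; rewrite yE y'E x'E !mxE mulrCA -invfM; congr (_ / _).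
by rewrite mulr_sumr; apply: eq_bigr => p _; rewrite mxE mulrCA.
Qed.

(** Transposing exchanges [x] and [y]. Each determines the other and they scale inversely, so rays
    correspond to rays. *)
Lemma two_rays_scaling_tr m k (a : 'I_m -> 'I_k -> K) :
  (0 < m)%N -> (0 < k)%N ->
  two_rays (fun x => exists y, scaling a x y) ->
  two_rays (fun y => exists x, scaling (fun j p => a p j) y x).
Proof.
move=> m0 k0 [x1 [x2 [[y1 s1] [y2 s2] neq s12]]].
exists y1, y2; split.
- by exists x1; apply/scaling_sym.
- by exists x2; apply/scaling_sym.
- move=> c yE; apply: (neq c^-1).
  have s1' := (scaling_sym _ _ _).1 s1; have s2' := (scaling_sym _ _ _).1 s2.
  exact: scaling_homogeneous k0 s1' s2' yE.
move=> y [x /scaling_sym s]; have [c c0 xE] := s12 x (ex_intro _ y s).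
exists c^-1; first by rewrite invr_eq0.
case: xE => xE; [left|right].
  exact: scaling_homogeneous m0 s1 s xE.
exact: scaling_homogeneous m0 s2 s xE.
Qed.

Variables (m k : nat) (p0 : 'I_m) (j0 j1 : 'I_k).
Hypotheses (m_gt1 : (1 < m)%N) (k_gt2 : (2 < k)%N) (j01 : j0 != j1).

Definition perturbed_ones (p : 'I_m) (j : 'I_k) : nat :=
  if p == p0 then (if j == j0 then 0 else if j == j1 then 2 else 1) else 1.

Let a p j : K := (perturbed_ones p j)%:R.
(** The number of rows other than [p0], all of which consist of ones. *)
Let w : K := m%:R - 1.

Let m_neq0 : m%:R != 0 :> K.
Proof. by rewrite pnatr_eq0; case: m m_gt1. Qed.

Let k_neq0 : k%:R != 0 :> K.
Proof. by rewrite pnatr_eq0; case: k k_gt2. Qed.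

Let w_neq0 : w != 0.
Proof. by rewrite subr_eq0 pnatr_eq1; case: m m_gt1 => [|[]]. Qed.

Let k2_neq0 : k%:R - 2 != 0 :> K.
Proof. by rewrite subr_eq0 eqr_nat gtn_eqF. Qed.

Let sum_cols (x : 'rV[K]_m) c u j : (forall p, p != p0 -> x 0 p = c) ->
  x 0 p0 = c * u -> \sum_p a p j * x 0 p = c * (w + a p0 j * u).
Proof.
move=> xc xu; rewrite (bigD1 p0) //= (eq_bigr (fun=> c)); last first.
  by move=> p pp0; rewrite xc // /a /perturbed_ones (negPf pp0) mul1r.
rewrite sumr_const cardC1 card_ord xu -[c *+ _]mulr_natr.
by rewrite -subn1 natrB ?(ltnW m_gt1) // /w; ring.
Qed.

Let sum_rows (F : K -> K) :
  \sum_j F (a p0 j) = F 0 + F 2 + (k%:R - 2) * F 1.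
Proof.
rewrite (bigD1 j0) //= (bigD1 j1) 1?eq_sym //= addrA; congr (_ + _ + _).
- by rewrite /a /perturbed_ones !eqxx.
- by rewrite /a /perturbed_ones !eqxx [j1 == j0]eq_sym (negPf j01).
rewrite (eq_bigr (fun=> F 1)); last first.
  by move=> j /andP[j0' j1']; rewrite /a /perturbed_ones eqxx (negPf j0') (negPf j1').
rewrite sumr_const -[F 1 *+ _]mulr_natl; congr (_ * _).
transitivity (#|~: [set j0; j1]|%:R : K).
  by congr _%:R; apply: eq_card => j; rewrite !inE negb_or.
have /(congr1 (fun i => i%:R : K)) := cardsC [set j0; j1].
rewrite cards2 j01 card_ord natrD => e; apply: (addrI 2).
by rewrite [LHS]e; ring.
Qed.

(** Normalise [x] to be [1] off [p0] and [u] at [p0]. The column equations give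
    [y_j = m / (w + a p0 j * u)]; requiring the [y_j] to sum to [k], which is the equation of an
    all-ones row, and clearing denominators yields this quadratic. *)
Definition scaling_quadratic (u : K) : K :=
  2 * (k%:R * w - m%:R) * u ^+ 2 + w * k%:R * (m%:R - 3) * u - k%:R * w ^+ 2.

Let quadraticE u : scaling_quadratic u =
  (k%:R * w - m%:R) * (w + 2 * u) * (w + u) - m%:R * w * (w + u)
  - m%:R * w * (k%:R - 2) * (w + 2 * u).
Proof.
rewrite /scaling_quadratic; have -> : m%:R = w + 1 by rewrite subrK.
by ring.
Qed.

(** No root is a pole: where a denominator vanishes, a single term of [quadraticE] survives. It is
    nonzero, at [w + u = 0] because [k] differs from [2]. *)
Let quadratic_neq0 u : scaling_quadratic u = 0 ->
  w + u != 0 /\ w + 2 * u != 0.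
Proof.
rewrite quadraticE => q0; split; apply/eqP => e.
  have u_w : w + 2 * u = - w.
    have -> : w + 2 * u = 2 * (w + u) - w by ring.
    by rewrite e mulr0 sub0r.
  move/eqP: q0; rewrite e u_w !mulr0 sub0r mulrN opprK oppr0 add0r.
  by rewrite !mulf_eq0 !(negPf m_neq0, negPf w_neq0, negPf k2_neq0).
have u_w : 2 * (w + u) = w.
  have -> : 2 * (w + u) = w + 2 * u + w by ring.
  by rewrite e add0r.
move/eqP: q0; rewrite e !mulr0 mul0r sub0r subr0 oppr_eq0 !mulf_eq0.
rewrite !(negPf m_neq0, negPf w_neq0) /= => /eqP e'.
by move: u_w w_neq0; rewrite e' mulr0 => <-; rewrite eqxx.
Qed.

Let sum_y u :
  \sum_j (w + a p0 j * u)^-1 = w^-1 + (w + 2 * u)^-1 + (k%:R - 2) / (w + u).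
Proof.
rewrite (sum_rows (fun b => (w + b * u)^-1)).
by rewrite mul0r addr0 mul1r.
Qed.

Let quadratic_sum u : w + u != 0 -> w + 2 * u != 0 ->
  m%:R * (w^-1 + (w + 2 * u)^-1 + (k%:R - 2) / (w + u)) = k%:R <->
  scaling_quadratic u = 0.
Proof.
move=> u1 u2.
have -> : scaling_quadratic u = w * (w + 2 * u) * (w + u) *
    (k%:R - m%:R * (w^-1 + (w + 2 * u)^-1 + (k%:R - 2) / (w + u))).
  by rewrite quadraticE; field; rewrite u1 u2 w_neq0.
split=> [->|/eqP]; first by rewrite subrr mulr0.
rewrite !mulf_eq0 (negPf u1) (negPf u2) (negPf w_neq0) /= subr_eq0.
by move/eqP.
Qed.

Definition scaling_ray (u : K) : 'rV[K]_m := \row_p (if p == p0 then u else 1).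

Lemma scaling_ray_sol u : scaling_quadratic u = 0 ->
  exists y, scaling a (scaling_ray u) y.
Proof.
move=> q0; have [u1 u2] := quadratic_neq0 q0.
have Yk := (quadratic_sum u1 u2).2 q0.
have wau j : w + a p0 j * u != 0.
  rewrite /a /perturbed_ones eqxx; case: ifP => _; first by rewrite mul0r addr0.
  by case: ifP => _; rewrite ?mul1r.
exists (\row_j (m%:R / (w + a p0 j * u))); split=> [p|j]; last first.
  rewrite (@sum_cols _ 1 u); first by rewrite mxE mul1r divfK.
    by move=> p pp0; rewrite mxE (negPf pp0).
  by rewrite mxE eqxx mul1r.
rewrite mxE; case: eqVneq => [->|pp0]; last first.
  rewrite mul1r -Yk -sum_y // mulr_sumr; apply: eq_bigr => j _.
  by rewrite mxE /a /perturbed_ones (negPf pp0) mul1r.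
rewrite (eq_bigr (fun j => m%:R * (a p0 j / (w + a p0 j * u)))); last first.
  by move=> j _; rewrite mxE mulrCA.
rewrite -mulr_sumr (sum_rows (fun b => b / (w + b * u))).
(* The equation of row [p0] follows by counting: the columns total [m * k] and the [w] other rows
   total [w * k], which leaves [k]. *)
transitivity (m%:R * k%:R
    - w * (m%:R * (w^-1 + (w + 2 * u)^-1 + (k%:R - 2) / (w + u)))).
  by rewrite mul0r !mul1r; field; rewrite u1 u2 w_neq0.
by rewrite Yk /w; ring.
Qed.

(** The all-ones rows have a common row sum factor [Y], so [x] takes one value [c] off [p0]. The
    rest is the normalisation behind [scaling_quadratic]. *)
Lemma scaling_rayP x y : scaling a x y ->
  exists c u, [/\ c != 0, scaling_quadratic u = 0 & x = c *: scaling_ray u].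
Proof.
move=> [xE yE].
pose Y := \sum_j y 0 j.
have xY p : p != p0 -> x 0 p * Y = k%:R.
  move=> pp0; rewrite -(xE p); congr (_ * _); apply: eq_bigr => j _.
  by rewrite /a /perturbed_ones (negPf pp0) mul1r.
have [p1 p1p0] : exists p1, p1 != p0.
  have : (0 < #|predC1 p0|)%N by rewrite cardC1 card_ord; case: m m_gt1 => [|[]].
  by case/card_gt0P => p1; exists p1.
have Y0 : Y != 0.
  by apply: contraNneq k_neq0 => Y0; rewrite -(xY p1 p1p0) Y0 mulr0.
pose c := k%:R / Y; have c0 : c != 0 by rewrite mulf_neq0 ?invr_eq0.
have xc p : p != p0 -> x 0 p = c by move/xY; rewrite /c => <-; rewrite mulfK.
pose u := x 0 p0 / c.
have xu : x 0 p0 = c * u by rewrite mulrCA divff ?mulr1.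
have yE' j : y 0 j * (c * (w + a p0 j * u)) = m%:R.
  by rewrite -(sum_cols j xc xu).
have wau j : w + a p0 j * u != 0.
  by apply: contraNneq m_neq0 => e; rewrite -(yE' j) e !mulr0.
have u2 : w + 2 * u != 0.
  by have := wau j1; rewrite /a /perturbed_ones !eqxx [j1 == j0]eq_sym (negPf j01).
(* As [k > 2], some column has entry [1] in row [p0]; its equation excludes [w + u = 0]. *)
have [j2 /andP[j20 j21]] : exists j2, (j2 != j0) && (j2 != j1).
  have : (0 < #|~: [set j0; j1]|)%N.
    have := cardsC [set j0; j1]; rewrite cards2 j01 card_ord.
    by move: k_gt2; lia.
  by case/card_gt0P => j2; rewrite !inE negb_or; exists j2.
have u1 : w + u != 0.
  by have := wau j2; rewrite /a /perturbed_ones eqxx (negPf j20) (negPf j21) mul1r.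
exists c, u; split=> //.
  apply/(quadratic_sum u1 u2); rewrite -sum_y // -[RHS](divfK Y0) -/c.
  rewrite mulr_sumr mulr_sumr; apply: eq_bigr => j _.
  by rewrite -(yE' j); field; rewrite wau.
apply/rowP => p; rewrite !mxE; case: eqVneq => [->|/xc ->] //.
by rewrite mulr1.
Qed.

Lemma two_rays_perturbed_ones (u1 u2 : K) : u1 != u2 ->
  (forall u, scaling_quadratic u = 0 <-> u = u1 \/ u = u2) ->
  two_rays (fun x => exists y, scaling a x y).
Proof.
move=> u12 roots; exists (scaling_ray u1), (scaling_ray u2); split.
- by apply: scaling_ray_sol; apply/roots; left.
- by apply: scaling_ray_sol; apply/roots; right.
- move=> c /rowP E.
  have [p1 p1p0] : exists p1, p1 != p0.
    have : (0 < #|predC1 p0|)%N by rewrite cardC1 card_ord; case: m m_gt1 => [|[]].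
    by case/card_gt0P => p1; exists p1.
  have := E p1; rewrite !mxE (negPf p1p0) mulr1 => c1.
  have := E p0; rewrite !mxE eqxx -c1 mul1r => u21.
  by rewrite u21 eqxx in u12.
move=> x [y /scaling_rayP[c [u [c0 /roots ru ->]]]]; exists c => //.
by case: ru => ->; [left|right].
Qed.

End MatrixScaling.

Lemma quadratic_two_roots (K : numClosedFieldType) (A B C : K) :
  A != 0 -> B ^+ 2 - 4 * A * C != 0 ->
  exists u1 u2, u1 != u2 /\
    forall u, A * u ^+ 2 + B * u + C = 0 <-> u = u1 \/ u = u2.
Proof.
move=> A0 D0; pose d := sqrtC (B ^+ 2 - 4 * A * C).
have dE : d ^+ 2 = B ^+ 2 - 4 * A * C by rewrite sqrtCK.
have d0 : d != 0 by rewrite sqrtC_eq0.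
have A20 : 2 * A != 0 by rewrite mulf_neq0 ?pnatr_eq0.
exists ((d - B) / (2 * A)), ((- d - B) / (2 * A)); split.
  apply: contra d0 => /eqP /(divIf A20) /addIr /eqP.
  by rewrite -addr_eq0 -mulr2n mulrn_eq0.
move=> u.
have fE : 4 * A * (A * u ^+ 2 + B * u + C)
    = (2 * A * u + B - d) * (2 * A * u + B + d).
  by rewrite -subr_sqr dE; ring.
have -> : (A * u ^+ 2 + B * u + C = 0) <->
    (2 * A * u + B - d) * (2 * A * u + B + d) = 0.
  rewrite -fE; split=> [->|/eqP]; first by rewrite mulr0.
  by rewrite !mulf_eq0 pnatr_eq0 (negPf A0) => /eqP.
split=> [/eqP|[]->]; last 2 first.
- by field.
- by field.
rewrite mulf_eq0 => /orP[] /eqP e; [left|right]; apply: (mulfI A20).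
  by rewrite [RHS]mulrC divfK // -[LHS]subr0 -e; ring.
by rewrite [RHS]mulrC divfK // -[LHS]subr0 -e; ring.
Qed.

(** The leading coefficient is positive, since [k * (m - 1) > m] for [m > 1] and [k > 2], and the
    constant term is negative. Hence the discriminant is positive. *)
Lemma two_rays_ones_0_2 (K : numClosedFieldType) m k (p0 : 'I_m)
    (j0 j1 : 'I_k) : (1 < m)%N -> (2 < k)%N -> j0 != j1 ->
  two_rays (fun x => exists y,
    scaling (fun p j => (perturbed_ones p0 j0 j1 p j)%:R : K) x y).
Proof.
move=> m_gt1 k_gt2 j01.
pose w : K := m%:R - 1.
have w_gt0 : 0 < w by rewrite subr_gt0 ltr1n.
have k_gt0 : 0 < k%:R :> K by rewrite ltr0n; lia.
have A_gt0 : 0 < 2 * (k%:R * w - m%:R).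
  rewrite mulr_gt0 ?ltr0n // subr_gt0 /w -(natrB _ (ltnW m_gt1)) -natrM ltr_nat.
  by rewrite subn1; nia.
have D_gt0 : 0 < (w * k%:R * (m%:R - 3)) ^+ 2
    - 4 * (2 * (k%:R * w - m%:R)) * (- (k%:R * w ^+ 2)).
  rewrite mulrN opprK ltr_wpDl //; last first.
    by rewrite (mulr_gt0 (mulr_gt0 _ A_gt0)) ?ltr0n // mulr_gt0 ?exprn_gt0.
  rewrite real_exprn_even_ge0 // !realM ?realn //; first by rewrite gtr0_real.
  by rewrite realB ?realn.
have [u1 [u2 [u12 roots]]] := quadratic_two_roots (lt0r_neq0 A_gt0) (lt0r_neq0 D_gt0).
exact: (two_rays_perturbed_ones p0 m_gt1 k_gt2 j01 u12 roots).
Qed.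

(** * Blocks with prescribed orthogonal entry vectors *)

Lemma extend_selection (P : finType) (n : nat) (i0 : 'I_n) (z : P)
    (A : {set 'I_n}) (f : 'I_n -> P) :
  {in A &, injective f} -> (forall i, i \in A -> f i != z) ->
  (#|P| - 1 <= n)%N ->
  exists h : 'I_n -> P, {in A, h =1 f} /\
    forall (V : nmodType) (F : P -> V), F z = 0 ->
      \sum_i F (h i) = \sum_c F c.
Proof.
move=> injf fz leP.
pose e := enum (~: A); pose B := z |: f @: A; pose rest := enum (~: B).
have ue : uniq e by exact: enum_uniq.
have cardB : #|B| = #|A|.+1.
  rewrite cardsU1 card_in_imset //; case: imsetP => [[i iA zE]|_ //].
  by have := fz i iA; rewrite -zE eqxx.
have le_rest : (size rest <= size e)%N.
  rewrite /rest /e -!cardE.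
  have := cardsC A; have := cardsC B; rewrite cardB card_ord; lia.
(* Outside [A], the indices not yet used, other than [z], are enumerated once each. The surplus
   positions get the default [z], where [F] vanishes. *)
exists (fun i => if i \in A then f i else nth z rest (index i e)).
split=> [i iA|V F F0]; first by rewrite iA.
rewrite (bigID (mem A)) /= (bigID (mem B)) /=; congr (_ + _).
  rewrite big_setU1 /=; last first.
    by apply/imsetP => -[i iA zE]; have := fz i iA; rewrite -zE eqxx.
  by rewrite F0 add0r big_imset //=; apply: eq_bigr => i ->.
transitivity (\sum_(i <- e) F (nth z rest (index i e))).
  rewrite /e big_enum /=.
  by apply: eq_big => [i|i]; rewrite ?inE // => /negPf ->.
transitivity (\sum_(c <- rest) F c); last first.
  by rewrite /rest big_enum /=; apply: eq_bigl => c; rewrite inE.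
rewrite (big_nth i0) (big_nth z) (big_cat_nat (n := size rest)) //=.
rewrite [X in _ + X]big_nat_cond [X in _ + X]big1 ?addr0; last first.
  move=> t /andP[/andP[le_t lt_t] _].
  by rewrite index_uniq // nth_default.
apply: eq_big_nat => t /andP[_ lt_t].
by rewrite index_uniq // (leq_trans lt_t).
Qed.

Section Householder.
Variables (F : fieldType) (P : finType) (I : eqType) (grp : P -> I) (v : P -> F).

Let u (a c : P) : F := if grp c == grp a then v c else 0.

Definition group_norm (i : I) : F := \sum_(c | grp c == i) v c ^+ 2.

(* Product of the reflections in the restrictions of [v] to the fibres of
   [grp]. *)
Definition fibre_reflection (c a : P) : F :=
  (c == a)%:R - 2 * v a / group_norm (grp a) * u a c.

(** Vectors on distinct fibres have disjoint supports, so only [a] and [b] in one fibre interact;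
    there it is the usual computation for a Householder reflection. *)
Lemma fibre_reflection_orthogonal a b :
  \sum_c fibre_reflection c a * fibre_reflection c b = (a == b)%:R.
Proof.
rewrite /fibre_reflection; set al := _ / _; set be := 2 * v b / _.
have d1 (G : P -> F) b' : \sum_c (c == b')%:R * G c = G b'.
  rewrite (bigD1 b') //= eqxx mul1r big1 ?addr0 // => c /negPf ->.
  by rewrite mul0r.
transitivity ((a == b)%:R - be * u b a - al * u a b
    + al * be * \sum_c u a c * u b c).
  transitivity (\sum_c ((c == a)%:R * (c == b)%:R - be * ((c == a)%:R * u b c)
    - al * ((c == b)%:R * u a c) + al * be * (u a c * u b c))).
    by apply: eq_bigr => c _; ring.
  by rewrite big_split /= !sumrB -!mulr_sumr !d1.
have [gab|gab] := eqVneq (grp a) (grp b); last first.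
  rewrite big1 => [|c _]; last first.
    rewrite /u; case: (eqVneq (grp c) (grp a)) => [->|_]; last by rewrite mul0r.
    by rewrite (negPf gab) mulr0.
  by rewrite /u [grp b == _]eq_sym (negPf gab) !mulr0 !subr0 addr0.
have -> : \sum_c u a c * u b c = group_norm (grp a).
  rewrite /group_norm [RHS]big_mkcond; apply: eq_bigr => c _.
  by rewrite /u gab; case: eqP => _; rewrite ?mulr0.
rewrite /u gab eqxx /al /be gab.
(* For a fibre of norm zero, [invr0] makes the reflection the identity. *)
have [->|N0] := eqVneq (group_norm (grp b)) 0.
  by rewrite invr0 !mulr0 !mul0r !subr0 addr0.
by field.
Qed.

End Householder.

Section OrthogonalBlocks.
Variables (R : rcfType) (m1 m2 n k : nat) (hk : (n * m2 = m1 + k)%N).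

Let row t := tail_row hk t.
Let blk t := tail_block hk t.

(** Rows of an orthogonal matrix [Q] indexed by pairs [(p, j)] are distributed over the blocks, and
    column [(p, j)] is scaled by the square root of [a p j]. The pair [(p0, j0)], where [a]
    vanishes, needs no block, whence the bound on [n]. The vector [v] defining [Q] is chosen so that
    the last [k] rows form an invertible diagonal matrix. *)
Lemma orthogonal_blocks (a : 'I_m2 -> 'I_k -> R) (p0 : 'I_m2) (j0 : 'I_k) :
  a p0 j0 = 0 -> (forall p j, (p, j) != (p0, j0) -> 0 < a p j) ->
  row j0 != p0 -> (m2 * k - 1 <= n)%N ->
  exists2 D : 'I_n -> 'M[R]_(m2, k),
    \matrix_(t, j) D (blk t) (row t) j \in unitmx &
    forall p j p' j', \sum_i D i p j * D i p' j'
      = if (p == p') && (j == j') then a p j else 0.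
Proof.
move=> a0 a_gt0 rj0 le_n.
(* One of the last [k] rows is chosen in each block that meets them; [j0] is the default for the
   other blocks. *)
pose rep i := odflt j0 [pick t | blk t == i].
have repK t : blk (rep (blk t)) = blk t.
  rewrite /rep; case: pickP => [t' /eqP //|/(_ t)]; by rewrite eqxx.
pose A := [set blk t | t : 'I_k]%SET.
pose f i := (row (rep i), rep i).
have fz i : i \in A -> f i != (p0, j0).
  by move=> _; apply/eqP => -[e1 e2]; move: rj0; rewrite -e1 -e2 eqxx.
have injf : {in A &, injective f}.
  by move=> _ _ /imsetP[t _ ->] /imsetP[t' _ ->] [_ e]; rewrite -repK e repK.
have le_P : (#|{: 'I_m2 * 'I_k}| - 1 <= n)%N by rewrite card_prod !card_ord.
have [h [hA hsum]] := extend_selection (blk j0) injf fz le_P.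
(* Representatives get weight [s] and the other tail rows weight [1]. Since [k < s ^+ 2], each fibre
   norm [N] of [v] lies in [[s ^+ 2, 2 * s ^+ 2)], so [1 - 2 * s ^+ 2 / N] is nonzero. *)
pose s : R := k.+1%:R.
have s_gt0 : 0 < s by rewrite ltr0n.
pose v (c : 'I_m2 * 'I_k) : R :=
  if c.1 == row c.2 then (if rep (blk c.2) == c.2 then s else 1) else 0.
pose Q := fibre_reflection (fun c : 'I_m2 * 'I_k => blk c.2) v.
have vz : v (p0, j0) = 0 by rewrite /v /= eq_sym (negPf rj0).
pose B (c : 'I_m2 * 'I_k) : R := Num.sqrt (a c.1 c.2).
have a_ge0 p j : 0 <= a p j.
  by have [[-> ->]|/a_gt0/ltW //] := eqVneq (p, j) (p0, j0); rewrite a0.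
exists (fun i => \matrix_(p, j) (B (p, j) * Q (h i) (p, j))); last first.
  move=> p j p' j'.
  pose G c := B (p, j) * B (p', j') * (Q c (p, j) * Q c (p', j')).
  transitivity (\sum_i G (h i)).
    by apply: eq_bigr => i _; rewrite !mxE mulrACA.
  rewrite hsum /G; last first.
    (* As [row j0 != p0], [v] vanishes at [(p0, j0)]. So row [(p0, j0)] of [Q] is a unit vector, and
       its only nonzero entry is multiplied by the square root of [a p0 j0 = 0]. *)
    have Qz b : b != (p0, j0) -> Q (p0, j0) b = 0.
      by move=> bz; rewrite /Q /fibre_reflection eq_sym (negPf bz) vz if_same mulr0 subr0.
    have [pj|/Qz ->] := eqVneq (p, j) (p0, j0); last by rewrite mul0r mulr0.
    by case: pj => -> ->; rewrite /B /= a0 sqrtr0 !mul0r.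
  rewrite -mulr_sumr fibre_reflection_orthogonal -[(p == p') && _]/((p, j) == (p', j')).
  case: eqP => [[<- <-]|_]; last by rewrite mulr0.
  by rewrite mulr1 -expr2 sqr_sqrtr.
set M := \matrix_(_, _) _.
have ME t j : M t j = B (row t, j) * Q (f (blk t)) (row t, j).
  by rewrite !mxE hA //; apply/imsetP; exists t.
(* A nonzero entry would need [v] to be nonzero at [(row t, j)], so [row t = row j], and [t], [j] in
   one block; then [t = j]. *)
have offdiag t j : t != j -> M t j = 0.
  move=> tj; rewrite ME /Q /fibre_reflection /v /= repK.
  have -> : (f (blk t) == (row t, j)) = false.
    apply/eqP => -[e1 e2]; move/eqP: tj; apply; rewrite -e2.
    by apply: (tail_inj (hk := hk)); rewrite -/(blk _) ?repK // e1.
  case: (eqVneq (row t) (row j)) => [rtj|_]; last first.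
    by rewrite mulr0 !mul0r subr0 mulr0.
  case: (eqVneq (blk t) (blk j)) => [btj|_]; last by rewrite mulr0 subr0 mulr0.
  by move/eqP: tj; case; exact: tail_inj btj rtj.
have diag t : M t t != 0.
  rewrite ME mulf_neq0 //.
    rewrite sqrtr_eq0 -ltNge a_gt0 //.
    by apply/eqP => -[e1 e2]; move: rj0; rewrite -e1 e2 eqxx.
  rewrite /Q /fibre_reflection /v /= !repK !eqxx.
  set N := group_norm _ _ _.
  have N_lt : s ^+ 2 <= N /\ N < 2 * s ^+ 2.
    have -> : N = \sum_(j | blk j == blk t)
        (if rep (blk j) == j then s else 1) ^+ 2.
      transitivity (\sum_(c : 'I_m2 * 'I_k | (blk c.2 == blk t) &&
          (c.1 == row c.2)) (if rep (blk c.2) == c.2 then s else 1) ^+ 2).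
        rewrite big_mkcondr; apply: eq_bigr => c _ /=.
        by case: ifP => _ //; rewrite expr0n.
      rewrite (reindex_onto (fun j => (row j, j)) snd) /=.
        by apply: eq_bigl => j; rewrite !eqxx !andbT.
      by move=> [p j] /= /andP[_ /eqP ->].
    rewrite (bigD1 (rep (blk t))) ?repK //= !eqxx; split.
      by rewrite lerDl sumr_ge0 // => j _; rewrite sqr_ge0.
    rewrite mulr_natl mulr2n ltrD2l.
    have -> : \sum_(j | (blk j == blk t) && (j != rep (blk t)))
        (if rep (blk j) == j then s else 1) ^+ 2
      = \sum_(j | (blk j == blk t) && (j != rep (blk t))) 1.
      apply: eq_bigr => j /andP[/eqP -> /negPf]; rewrite eq_sym => ->.
      by rewrite expr1n.
    rewrite sumr_const (@le_lt_trans _ _ k%:R) //.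
      by rewrite ler_nat -[leqRHS]card_ord max_card.
    by rewrite /s expr2 -natrM ltr_nat; lia.
  have N0 : N != 0 by rewrite gt_eqF // (lt_le_trans _ N_lt.1) ?exprn_gt0.
  case: (eqVneq (rep (blk t)) t) => [e|e].
    rewrite /f e eqxx subr_eq0 eq_sym.
    apply/eqP => E; have {}E : 2 * s / N * s = 1 := E.
    have NE : 2 * s ^+ 2 = N.
      by rewrite -[RHS]mul1r -[X in X * N]E mulrAC divfK // expr2 mulrA.
    by move: N_lt.2; rewrite NE ltxx.
  rewrite /f xpair_eqE (negPf e) andbF sub0r oppr_eq0 mulr1.
  by rewrite !mulf_neq0 ?invr_eq0 ?pnatr_eq0 // gt_eqF.
have -> : M = diag_mx (\row_t M t t).
  apply/matrixP => t j; rewrite [RHS]mxE; case: eqVneq => [->|/offdiag ->].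
    by rewrite [in RHS]mxE mulr1n.
  by rewrite mulr0n.
by apply/unitmx_diag => t; rewrite mxE.
Qed.

End OrthogonalBlocks.

(** * The case [m2 = k = 2] *)

Section TwoByTwo.
Variable K : numFieldType.

(* The map [S |-> E01 S E10 + E10 S E01 + S], with the third block [-1] placed
   last so that the last two rows of the data are those of [-1]. *)
Definition blocks22 (n : nat) (i : 'I_n) : 'M[K]_2 :=
  if i == n.-1 :> nat then - 1%:M
  else if i == 0%N :> nat then delta_mx 0 1
  else if i == 1%N :> nat then delta_mx 1 0 else 0.

Lemma sum_blocks22 n (V : nmodType) (G : 'M[K]_2 -> V) : (2 < n)%N -> G 0 = 0 ->
  \sum_(i < n) G (blocks22 i) = G (- 1%:M) + G (delta_mx 0 1) + G (delta_mx 1 0).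
Proof.
case: n => [|[|[|r]]] // _ G0.
rewrite big_ord_recr !big_ord_recl big1 => [|i _]; last first.
  rewrite /blocks22 /= /bump /= !add1n ltn_eqF //.
  by have := ltn_ord i; lia.
by rewrite /blocks22 /= !eqxx /= /bump /= addr0 [LHS]addrC addrA.
Qed.

(** For [blocks22], both [block_gram] and [block_push] are this map: it puts the trace in both
    diagonal positions. *)
Definition spread (X : 'M[K]_2) : 'M[K]_2 :=
  \matrix_(i, j) if i == j then X 0 0 + X 1 1 else X i j.

Lemma matrix2P (A B : 'M[K]_2) :
  A 0 0 = B 0 0 -> A 0 1 = B 0 1 -> A 1 0 = B 1 0 -> A 1 1 = B 1 1 -> A = B.
Proof.
move=> e00 e01 e10 e11.
have ord2 (i : 'I_2) : i = 0 \/ i = 1.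
  by case: i => [[|[|//]] ?]; [left|right]; apply: val_inj.
by apply/matrixP => i j; case: (ord2 i) => ->; case: (ord2 j) => ->.
Qed.

Lemma mul_delta_sandwich r (X : 'M[K]_r) (i j l t : 'I_r) :
  delta_mx i j *m X *m delta_mx l t = X j l *: delta_mx i t.
Proof.
rewrite -(@mul_delta_mx K r 1 r 0 i j) -(@mul_delta_mx K r 1 r 0 l t).
rewrite -!mulmxA (mulmxA X) -colE (mulmxA (delta_mx 0 j)) -rowE.
rewrite [row _ _]mx11_scalar mul_scalar_mx -scalemxAr mul_delta_mx.
by rewrite !mxE.
Qed.

Lemma block_push22 n X : (2 < n)%N ->
  block_push (@blocks22 n) X = spread X.
Proof.
move=> n_gt2; rewrite /block_push.
rewrite (sum_blocks22 (G := fun D => D *m X *m D^T)) ?mul0mx //.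
rewrite [(- _)^T]linearN /= trmx1 !mulNmx mulmxN opprK mul1mx mulmx1.
rewrite !trmx_delta !mul_delta_sandwich.
by apply: matrix2P; rewrite !mxE /= ?mulr1 ?mulr0 ?addr0 // addrC.
Qed.

Lemma block_gram22 n S : (2 < n)%N ->
  block_gram (@blocks22 n) S = spread S.
Proof.
move=> n_gt2; rewrite /block_gram.
rewrite (sum_blocks22 (G := fun D => D^T *m S *m D)) ?mulmx0 //.
rewrite [(- _)^T]linearN /= trmx1 !mulNmx mulmxN opprK mul1mx mulmx1.
rewrite !trmx_delta !mul_delta_sandwich.
by apply: matrix2P; rewrite !mxE /= ?mulr1 ?mulr0 ?addr0 // addrC.
Qed.

Definition swap_mx : 'M[K]_2 := \matrix_(i, j) (i != j)%:R.

Lemma swap_mxK : swap_mx *m swap_mx = 1%:M.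
Proof.
by apply: matrix2P; rewrite !mxE !big_ord_recl big_ord0 !mxE /=; ring.
Qed.

Lemma spread1 : spread 1%:M = 2 *: 1%:M.
Proof. by apply: matrix2P; rewrite !mxE /=; ring. Qed.

Lemma spread_swap : spread swap_mx = swap_mx.
Proof. by apply: matrix2P; rewrite !mxE /=; ring. Qed.

Lemma spreadZ c X : spread (c *: X) = c *: spread X.
Proof. by apply: matrix2P; rewrite !mxE /=; ring. Qed.

Lemma mul2E (A B : 'M[K]_2) i j : (A *m B) i j = A i 0 * B 0 j + A i 1 * B 1 j.
Proof.
rewrite mxE !big_ord_recl big_ord0 addr0; congr (_ + A _ _ * B _ _).
all: exact: val_inj.
Qed.

(** Here [x], [y], [z] are the entries of a symmetric [S] and [a], [b], [c], [d] those of the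
    inverse [W] of [spread S]; the hypotheses come from [S *m spread W = 1] and [spread S *m W = 1].
    With [t] the determinant of [spread S], Cramer's rule eliminates [W] and leaves
    [2 * x * s = s ^+ 2 = 2 * z * s] and [y * (2 * s - x) = 0]. The case [s = 0] gives the swap
    matrix, the other the identity. *)
Let spread_system (x y z a b c d : K) :
  x * (a + d) + y * c = 1 -> x * b + y * (a + d) = 0 ->
  y * b + z * (a + d) = 1 ->
  (x + z) * a + y * c = 1 -> (x + z) * b + y * d = 0 ->
  y * a + (x + z) * c = 0 -> y * b + (x + z) * d = 1 ->
  [/\ y = 0, x = z & x != 0] \/ [/\ x = 0, z = 0 & y != 0].
Proof.
move=> v00 v01 v11 w00 w01 w10 w11.
pose s := x + z; rewrite -/s in w00 w01 w10 w11; pose t := s ^+ 2 - y ^+ 2.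
have ta : t * a = s.
  transitivity (s * (s * a + y * c) - y * (y * a + s * c)); first by rewrite /t; ring.
  by rewrite w00 w10 mulr1 mulr0 subr0.
have tc : t * c = - y.
  transitivity (s * (y * a + s * c) - y * (s * a + y * c)); first by rewrite /t; ring.
  by rewrite w00 w10 mulr1 mulr0 sub0r.
have tb : t * b = - y.
  transitivity (s * (s * b + y * d) - y * (y * b + s * d)); first by rewrite /t; ring.
  by rewrite w01 w11 mulr1 mulr0 sub0r.
have td : t * d = s.
  transitivity (s * (y * b + s * d) - y * (s * b + y * d)); first by rewrite /t; ring.
  by rewrite w01 w11 mulr1 mulr0 subr0.
have t0 : t != 0.
  apply/eqP => t0; move/eqP: w00; rewrite -ta t0 mul0r mul0r add0r.
  have -> : y = 0 by rewrite -[y]opprK -tc t0 mul0r oppr0.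
  by rewrite mul0r eq_sym oner_eq0.
have e1 : 2 * x * s = s ^+ 2.
  transitivity (t * (x * (a + d) + y * c) + y ^+ 2); last by rewrite v00 /t; ring.
  have -> : t * (x * (a + d) + y * c) = x * (t * a + t * d) + y * (t * c) by ring.
  by rewrite ta td tc; ring.
have e2 : 2 * z * s = s ^+ 2.
  transitivity (t * (y * b + z * (a + d)) + y ^+ 2); last by rewrite v11 /t; ring.
  have -> : t * (y * b + z * (a + d)) = z * (t * a + t * d) + y * (t * b) by ring.
  by rewrite ta td tb; ring.
have e3 : y * (2 * s - x) = 0.
  transitivity (t * (x * b + y * (a + d))); last by rewrite v01 mulr0.
  have -> : t * (x * b + y * (a + d)) = x * (t * b) + y * (t * a + t * d) by ring.
  by rewrite ta td tb; ring.
have [s0|s0] := eqVneq s 0.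
  have y0 : y != 0.
    by apply: contraNneq t0 => y0; rewrite /t s0 y0 !expr0n subr0.
  right; move/eqP: e3; rewrite mulf_eq0 (negPf y0) s0 mulr0 sub0r oppr_eq0.
  by move=> /eqP x0; split=> //; move: s0; rewrite /s x0 add0r.
have xs : 2 * x = s by apply: (mulIf s0); rewrite e1 expr2.
have zs : 2 * z = s by apply: (mulIf s0); rewrite e2 expr2.
have x0 : x != 0 by apply: contraNneq s0 => x0; rewrite -xs x0 mulr0.
left; split=> //; last by apply: (@mulfI _ 2); rewrite ?pnatr_eq0 // xs zs.
apply/eqP; move/eqP: e3; rewrite mulf_eq0 => /orP[//|].
have -> : 2 * s - x = 3 * x by rewrite -xs; ring.
by rewrite mulf_eq0 pnatr_eq0 (negPf x0).
Qed.

Lemma spread_solution S : S^T = S -> S \in unitmx -> spread S \in unitmx ->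
  spread (invmx (spread S)) = invmx S ->
  exists2 c, c != 0 & S = c *: 1%:M \/ S = c *: swap_mx.
Proof.
move=> sS uS uP E.
have := mulmxV uP; have := mulmxV uS; rewrite -E; set W := invmx (spread S).
move=> /matrixP SV /matrixP PW.
have y_sym : S 1 0 = S 0 1 by rewrite -[in LHS]sS mxE.
have := (PW 0 0, PW 0 1, PW 1 0, PW 1 1).
have := (SV 0 0, SV 0 1, SV 1 0, SV 1 1).
rewrite !mul2E !mxE /= y_sym.
set x := S 0 0; set y := S 0 1; set z := S 1 1.
set a := W 0 0; set b := W 0 1; set c := W 1 0; set d := W 1 1.
rewrite !mulr1n !mulr0n.
move=> [[[v00 v01] v10] v11] [[[w00 w01] w10] w11].
have [[y0 xz x0]|[x0 z0 y0]] := spread_system v00 v01 v11 w00 w01 w10 w11.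
  exists x => //; left; apply: matrix2P; rewrite !mxE /= ?mulr1 ?mulr0 //.
  by rewrite y_sym.
exists y => //; right; apply: matrix2P; rewrite !mxE /= ?mulr1 ?mulr0 //.
Qed.

Lemma two_rays_blocks22 n : (2 < n)%N -> two_rays (block_solution (@blocks22 n)).
Proof.
move=> n_gt2.
have u2 : (2 : K) != 0 by rewrite pnatr_eq0.
have solE S : block_solution (@blocks22 n) S <->
    [/\ S^T = S, S \in unitmx, spread S \in unitmx &
        spread (invmx (spread S)) = invmx S].
  rewrite /block_solution block_gram22 // block_push22 //.
  by split=> -[sS uS uP E]; split=> //; [exact: (can_inj (scalerK u2) E)|rewrite E].
have swapV : invmx swap_mx = swap_mx by apply/invmx_uniq/swap_mxK.
have swapU : swap_mx \in unitmx by have [] := mulmx1_unit swap_mxK.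
exists 1%:M, swap_mx; split.
- apply/solE; rewrite trmx1 unitmx1 invmx1 spread1 unitmxZ ?unitmx1 ?unitfE //.
  split=> //; rewrite invmxZ ?unitmxZ ?unitmx1 ?unitfE // invmx1 spreadZ spread1.
  by rewrite scalerA mulVf ?scale1r.
- apply/solE; rewrite spread_swap swapV spread_swap swapU; split=> //.
  by apply: matrix2P; rewrite !mxE.
- move=> c /matrixP /(_ 0 1); rewrite !mxE /= mulr0 => /eqP.
  by rewrite oner_eq0.
by move=> S /solE[sS uS uP E]; exact: spread_solution.
Qed.

End TwoByTwo.

(** * Assembling the cases *)

Lemma multiple_solutions_of_scaling (R : realType) (m1 m2 n k : nat)
    (hm1 : (n * m2 = m1 + k)%N) (N : 'I_m2 -> 'I_k -> nat) p0 j0 :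
  (0 < m2)%N -> (0 < k)%N -> (m2 * k - 1 <= n)%N ->
  tail_row hm1 j0 != p0 -> N p0 j0 = 0%N ->
  (forall p j, (p, j) != (p0, j0) -> (0 < N p j)%N) ->
  two_rays (fun x => exists y, scaling (fun p j => (N p j)%:R : R[i]) x y) ->
  exists Y : 'I_n -> 'M[R]_(m1, m2),
    [/\ data_lead hm1 Y \in unitmx,
        finite_set (kronecker_solutions hm1 Y),
        (exists P Q : set 'M[R[i]]_m2,
          [/\ kronecker_solutions hm1 Y P,
              kronecker_solutions hm1 Y Q & P <> Q]) &
        (1 < ml_multiplicity hm1 Y)%N].
Proof.
move=> m2_gt0 k_gt0 hn rj0 N0 N_gt0 rays.
have a0 : (N p0 j0)%:R = 0 :> R by rewrite N0.
have a_gt0 p j : (p, j) != (p0, j0) -> 0 < (N p j)%:R :> R.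
  by move/N_gt0; rewrite ltr0n.
have [D uD DE] := orthogonal_blocks a0 a_gt0 rj0 hn.
apply: (multiple_solutions_of_blocks uD); apply: two_rays_diag rays => // p j p' j'.
(* The entries of [N] are natural numbers, so the real inner products map to the coefficients of the
   complex scaling problem. *)
have := congr1 (real_complex R) (DE p j p' j').
rewrite rmorph_sum; under eq_bigr do rewrite rmorphM.
under [in X in _ -> X]eq_bigr do rewrite !mxE.
by move=> ->; case: ifP => _; rewrite ?rmorph0 ?rmorph_nat.
Qed.

Lemma exists_neq n (i : 'I_n) : (1 < n)%N -> exists j, i != j.
Proof.
case: n i => [|[|n]] // i _.
have /card_gt0P[j] : (0 < #|predC1 i|)%N by rewrite cardC1 card_ord.
by rewrite inE eq_sym => ij; exists j.
Qed.

Theorem proposition4p4 (R : realType) (m1 m2 n k : nat)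
  (hm2 : (1 < m2)%N) (hk : (1 < k)%N) (hn : (m2 * k - 1 <= n)%N)
  (hm1 : (n * m2 = m1 + k)%N) :
  exists Y : 'I_n -> 'M[R]_(m1, m2),
    [/\ data_lead hm1 Y \in unitmx,
        finite_set (kronecker_solutions hm1 Y),
        (exists P Q : set 'M[R[i]]_m2,
          [/\ kronecker_solutions hm1 Y P,
              kronecker_solutions hm1 Y Q & P <> Q]) &
        (1 < ml_multiplicity hm1 Y)%N].
Proof.
pose j0 : 'I_k := Ordinal (ltnW hk).
(* The zero entry [(p0, j0)] must avoid the row index of the tail row [j0]. *)
have [p0 rj0] := exists_neq (tail_row hm1 j0) hm2.
have [k_gt2|k_le2] := ltnP 2 k.
  have [j1 j01] := exists_neq j0 hk.
  apply: (@multiple_solutions_of_scaling R _ _ _ _ _ (perturbed_ones p0 j0 j1) p0 j0);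
    rewrite ?(ltnW hm2) ?(ltnW hk) //.
  - by rewrite /perturbed_ones !eqxx.
  - move=> p j; rewrite /perturbed_ones xpair_eqE.
    by case: eqP => //= _ /negPf ->; case: ifP.
  - exact: two_rays_ones_0_2.
have [m2_gt2|m2_le2] := ltnP 2 m2.
  have [p1 p01] := exists_neq p0 hm2.
  apply: (@multiple_solutions_of_scaling R _ _ _ _ _
    (fun p j => perturbed_ones j0 p0 p1 j p) p0 j0);
    rewrite ?(ltnW hm2) ?(ltnW hk) //.
  - by rewrite /perturbed_ones !eqxx.
  - move=> p j; rewrite /perturbed_ones xpair_eqE andbC.
    by case: eqP => //= _ /negPf ->; case: ifP.
  (* For [k = 2] and [m2 > 2] the transposed problem has more than two columns. *)
  - apply: (two_rays_scaling_tr (ltnW hk) (ltnW hm2)).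
    exact: two_rays_ones_0_2.
have m22 : m2 = 2%N by apply/eqP; rewrite eqn_leq m2_le2.
have k2 : k = 2%N by apply/eqP; rewrite eqn_leq k_le2.
subst m2 k; have n_gt2 : (2 < n)%N by [].
apply: (multiple_solutions_of_blocks (D := @blocks22 R n)); last first.
  have -> : (fun i => map_mx (real_complex R) (blocks22 R i))
      = @blocks22 R[i] n.
    apply/funext => i; rewrite /blocks22.
    by case: ifP => _; [|do 2?case: ifP => _];
      rewrite ?map_mxN ?map_mx1 ?map_delta_mx ?map_mx0.
  exact: two_rays_blocks22.
(* The last two rows are exactly the last block, which is [-1]. *)
have -> : tail_mx hm1 (@blocks22 R n) = - 1%:M.
  apply/matrixP => t j; have tE := tail_indexE hm1 t.
  have := ltn_ord t; have := ltn_ord (tail_row hm1 t).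
  have := ltn_ord (tail_block hm1 t) => lt1 lt2 lt3.
  have bE : (tail_block hm1 t = n.-1 :> nat)%N by lia.
  have rE : tail_row hm1 t = t by apply: val_inj => /=; lia.
  by rewrite mxE /blocks22 bE eqxx rE.
by rewrite -scaleN1r unitmxZ ?unitrN1 ?unitmx1.
Qed.
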